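(* Let $G$ be a finite solvable PNC-group and let $p=\min\pi(G)$ be the smallest prime divisor of $|G|$. Then $G$ is $p$-nilpotent.
   Context: $\pi(G)$ is the set of prime divisors of $|G|$. For a subgroup $H$ of $G$, $H^G$ denotes the normal closure of $H$ in $G$. $H$ is an NC-subgroup of $G$ if $H^GN_G(H)=G$; $G$ is a PNC-group if every subgroup of $G$ is an NC-subgroup of $G$. A group is $p$-nilpotent if it has a normal $p$-complement. *)

(* Defs.v *)
From mathcomp Require Import all_boot all_fingroup all_solvable.

Set Implicit Arguments.
Unset Strict Implicit.
Unset Printing Implicit Defensive.

Local Open Scope group_scope.

Section Defs.

Variable gT : finGroupType.
Implicit Types G H : {group gT}.

Definition normal_closure G H : {set gT} := <<class_support H G>>.

(* The equation is between sets: H^G N_G(H) is the pointwise product. *)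
Definition NC_subgroup G H : bool :=
  (H \subset G) && (normal_closure G H * 'N_G(H) == G).

Definition PNC_group G : Prop :=
  forall H : {group gT}, H \subset G -> NC_subgroup G H.

(* A normal p-complement is a normal Hall p'-subgroup. *)
Definition p_nilpotent (p : nat) G : Prop :=
  exists K : {group gT}, K <| G /\ p^'.-Hall(G) K.

End Defs.

(* Main.v *)
(** In a PNC-group normality is transitive: if [H <| K <| G], then [H^G] lies
    in [K], hence normalises [H], and [G = H^G N_G(H) = N_G(H)].  Consequently
    a nontrivial solvable PNC-group has a normal subgroup [N] of prime order
    [q], found inside an abelian normal subgroup.  By induction [G / N] has a
    normal [p]-complement [K / N].  If [q != p], then [K] is a [p]-complement
    of [G]; if [q = p], then [N] is central because [|Aut N| = p - 1] has no
    prime divisor in [\pi(G)], so [K = N \x L] by Schur-Zassenhaus and [L] is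
    characteristic in [K]. *)
Require Import Defs.
From mathcomp Require Import all_boot all_fingroup all_solvable.

Local Open Scope group_scope.

(** These are the T-groups. The induction runs on this property, which passes to quotients by the
    correspondence of normal subgroups. *)
Definition normality_transitive {gT : finGroupType} (G : {group gT}) : Prop :=
  forall H K : {group gT}, H <| K -> K <| G -> H <| G.

Lemma PNC_normality_transitive {gT : finGroupType} (G : {group gT}) :
  PNC_group G -> normality_transitive G.
Proof.
move=> PNC H K nsHK nsKG.
have sHG : H \subset G := subset_trans (normal_sub nsHK) (normal_sub nsKG).
have /andP[_ /eqP defG] := PNC H sHG.
rewrite /normal sHG -defG mul_subG ?subsetIr //.
apply: subset_trans (normal_norm nsHK).
by rewrite gen_subG class_support_sub_norm ?(normal_sub nsHK) ?(normal_norm nsKG).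
Qed.

Lemma quotient_normality_transitive {gT : finGroupType} (G N : {group gT}) :
  N <| G -> normality_transitive G -> normality_transitive (G / N)%G.
Proof.
move=> nsNG trG H K nsHK /(inv_quotientN nsNG)[L defK sNL nsLG].
have nsNL : N <| L := normalS sNL (normal_sub nsLG) nsNG.
move: nsHK; rewrite defK => /(inv_quotientN nsNL)[M -> sNM nsML].
exact/quotient_normal/(trG _ _ nsML nsLG).
Qed.

Lemma exists_normal_prime_order {gT : finGroupType} (G : {group gT}) :
    solvable G -> normality_transitive G -> G :!=: 1 ->
  exists N : {group gT}, N <| G /\ prime #|N|.
Proof.
move=> solG trG ntG.
have [A [_ nsAG ntA abelA]] := solvable_norm_abelem solG (normal_refl G) ntG.
have pr_q : prime (pdiv #|A|) by rewrite pdiv_prime // cardG_gt1.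
have [x Ax ox] := Cauchy pr_q (pdiv_dvd _).
exists <[x]>%G; rewrite -orderE ox; split=> //.
(* Every subgroup of the abelian group [A] is normal in [A], so transitivity makes [<[x]>] normal in
   [G]. *)
by apply: trG nsAG; rewrite -sub_abelian_normal ?cycle_subG // (abelem_abelian abelA).
Qed.

Lemma normal_min_prime_central {gT : finGroupType} (G N : {group gT}) :
    N <| G -> prime #|N| -> (forall q : nat, q \in \pi(G) -> #|N| <= q) ->
  G \subset 'C(N).
Proof.
move=> nsNG prN minN.
set m := #|conj_aut N @* G|.
have m_dvd_Aut : m %| #|N|.-1.
  by rewrite -(totient_prime prN) -card_Aut_cyclic ?prime_cyclic // cardSg ?Aut_conj_aut.
have m_lt_N : m < #|N|.
  rewrite -(prednK (prime_gt0 prN)) ltnS dvdn_leq // -ltnS.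
  by rewrite (prednK (prime_gt0 prN)) prime_gt1.
have m1 : conj_aut N @* G = 1.
  (* If [m > 1], its least prime divisor divides [#|G|], hence is at least [#|N|], against
     [m < #|N|]. *)
  apply: contraTeq m_lt_N; rewrite -cardG_gt1 -leqNgt => m_gt1.
  apply: leq_trans (pdiv_leq (ltnW m_gt1)).
  rewrite minN // mem_primes pdiv_prime // cardG_gt0.
  exact: dvdn_trans (pdiv_dvd _) (dvdn_morphim _ _).
by rewrite -ker_conj_aut ker_trivg_morphim normal_norm //= m1.
Qed.

Lemma p_nilpotent_central_ext {gT : finGroupType} (p : nat)
    (G N : {group gT}) :
    p.-group N -> N <| G -> G \subset 'C(N) ->
  p_nilpotent p (G / N)%G -> p_nilpotent p G.
Proof.
move=> pN nsNG cNG [Kb [nsKb hallKb]].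
have [K defK sNK nsKG] := inv_quotientN nsNG nsKb.
have nsNK : N <| K := normalS sNK (normal_sub nsKG) nsNG.
move: hallKb; rewrite defK => /and3P[_ p'K pKi].
have hallN : p.-Hall(K) N.
  by rewrite /pHall sNK pN -card_quotient ?normal_norm.
have /splitsP[L /complP[tiNL defNL]] :=
  SchurZassenhaus_split (pHall_Hall hallN) nsNK.
have sLK : L \subset K by rewrite -defNL mulG_subr.
have nsLK : L <| K.
  (* [K = N * L], where [N] normalises [L] because it is centralised by [G]. *)
  rewrite /normal sLK -defNL mul_subG ?normG // cents_norm // centsC.
  exact: subset_trans sLK (subset_trans (normal_sub nsKG) cNG).
have hallL : p^'.-Hall(K) L by rewrite -(compl_pHall _ hallN); apply/complP.
exists L; split.
  (* As a normal Hall subgroup, [L] equals ['O_p^'(K)]. *)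
  apply: char_normal_trans nsKG.
  by rewrite -(normal_Hall_pcore hallL nsLK) pcore_char.
rewrite pHallE (subset_trans sLK (normal_sub nsKG)) /=.
(* The index of [K] in [G] is that of [K / N] in [G / N], a power of [p], so [#|G|] and [#|K|] have
   the same [p^']-part. *)
rewrite (card_Hall hallL) -(Lagrange (normal_sub nsKG)) partnM // eq_sym.
rewrite -(index_quotient_eq _ (normal_sub nsKG) (normal_norm nsNG)); last first.
  exact: subset_trans (subsetIr _ _) sNK.
by rewrite (part_p'nat pKi) muln1.
Qed.

Lemma p_nilpotent_p'ext {gT : finGroupType} (p : nat) (G N : {group gT}) :
  p^'.-group N -> N <| G -> p_nilpotent p (G / N)%G -> p_nilpotent p G.
Proof.
move=> p'N nsNG [Kb [nsKb hallKb]].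
have [K defK sNK nsKG] := inv_quotientN nsNG nsKb.
exists K; split=> //.
have nsNK : N <| K := normalS sNK (normal_sub nsKG) nsNG.
by rewrite -(pquotient_pHall p'N nsNG nsNK) -defK.
Qed.

(** Here [p] is a lower bound of [\pi(G)] rather than a member, a form that survives in [G / N],
    whose order may have lost the factor [p]. *)
Lemma p_nilpotent_min_prime {gT : finGroupType} (G : {group gT}) (p : nat) :
    solvable G -> normality_transitive G ->
    (forall q : nat, q \in \pi(G) -> p <= q) ->
  p_nilpotent p G.
Proof.
have [n] := ubnP #|G|; elim: n => // n IHn in gT G * => /ltnSE leGn solG trG minp.
have [G1 | ntG] := eqVneq (G : {set gT}) 1.
  by exists G; rewrite normal_refl pHallE subxx G1 cards1 /= part_p'nat // partn1.
have [N [nsNG prN]] := exists_normal_prime_order _ solG trG ntG.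
have nilGN : p_nilpotent p (G / N)%G.
  apply: IHn; rewrite ?quotient_sol //.
  - by rewrite (leq_trans _ leGn) // ltn_quotient ?normal_sub // -cardG_gt1 prime_gt1.
  - exact: quotient_normality_transitive.
  - by move=> q /(pi_of_dvd (dvdn_quotient _ _) (cardG_gt0 G)); apply: minp.
have [eqNp | neqNp] := eqVneq #|N| p; last first.
  by apply: p_nilpotent_p'ext nilGN; rewrite // /pgroup pnatE ?inE.
apply: p_nilpotent_central_ext nilGN => //; first by rewrite /pgroup eqNp pnat_id // -eqNp.
by apply: normal_min_prime_central; rewrite ?eqNp // -eqNp.
Qed.

Theorem proposition2p10 (gT : finGroupType) (G : {group gT}) (p : nat)
    (G_sol : solvable G) (G_PNC : PNC_group G)
    (p_in_piG : p \in \pi(G))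
    (p_min : forall q : nat, q \in \pi(G) -> p <= q) :
  p_nilpotent p G.
Proof. exact: p_nilpotent_min_prime (PNC_normality_transitive _ G_PNC) p_min. Qed.
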